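(* Let $G$ be a $D$-regular finite connected graph of diameter $L$. Assume that $G$ is self-centered and satisfies $\Lambda\left(\frac{2D}{L}-2\right)$. Then $G$ is strongly spherical.
   Context: All graphs are finite, simple, undirected, unweighted, connected, and have at least one edge. $d$ denotes the combinatorial distance and $\mathrm{diam}(G)=\max_{x,y}d(x,y)$; $N_x$ is the set of neighbours of $x$ and $N_{xy}=N_x\cap N_y$. A graph $G$ is self-centered if for every vertex $x$ there is a vertex $\overline x$ with $d(x,\overline x)=\mathrm{diam}(G)$. A regular graph $G$ satisfies $\Lambda(m)$ at an edge $e=\{x,y\}$ if (i) $e$ is contained in at least $m$ triangles and (ii) there is a perfect matching (consisting of edges of $G$) between the neighbours of $x$ and the neighbours of $y$ not involved in these triangles, i.e. between $N_x\setminus(N_{xy}\cup\{y\})$ and $N_y\setminus(N_{xy}\cup\{x\})$. $G$ satisfies $\Lambda(m)$ if it satisfies $\Lambda(m)$ at each edge. The interval between $x,y\in V$ is $[x,y]=\{z\in V: d(x,z)+d(z,y)=d(x,y)\}$. A graph $G=(V,E)$ is strongly spherical if $G$ and the induced subgraphs of all its intervals are antipodal, that is: for every $x\in V$ there is $\overline x\in V$ with $[x,\overline x]=V$; and for every pair $x\ne y$ in $V$ and every $z\in[x,y]$ there is $\overline z\in[x,y]$ with $[x,y]=[z,\overline z]$. *)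

(* Defs.v *)
From HB Require Import structures.
From mathcomp Require Import all_boot all_order all_algebra.

Set Implicit Arguments.
Unset Strict Implicit.
Unset Printing Implicit Defensive.

Import Order.TTheory GRing.Theory Num.Theory.

(* A finite simple graph is a symmetric irreflexive relation [e] on a finite
   type [T] of vertices. *)
Section Graphs.

Variables (T : finType) (e : rel T).

Definition connected_graph : Prop := forall x y : T, connect e x y.

(* Least length of a walk from [x] to [y]. In a connected graph some walk has
   fewer than #|T| edges, so the bounded search finds it; the value is #|T| if
   there is no walk at all. *)
Definition dist (x y : T) : nat :=
  find (fun n => [exists p : n.-tuple T, path e x p && (last x p == y)])
       (iota 0 #|T|).

Definition diam : nat := \max_(x : T) \max_(y : T) dist x y.

Definition self_centered : Prop :=
  forall x : T, exists x' : T, dist x x' = diam.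

Definition nbrs (x : T) : {set T} := [set z | e x z].

Definition common_nbrs (x y : T) : {set T} := nbrs x :&: nbrs y.

Definition regular (D : nat) : Prop := forall x : T, #|nbrs x| = D.

Definition triangles (x y : T) : {set {set T}} :=
  [set t : {set T} | [&& #|t| == 3, x \in t, y \in t &
                         [forall a in t, forall b in t, (a != b) ==> e a b]]].

(* [M] is a set of pairwise disjoint edges, each joining [A] to [B], that
   covers [A :|: B]. *)
Definition perfect_matching (A B : {set T}) (M : {set {set T}}) : Prop :=
  partition M (A :|: B) /\
  (forall f, f \in M ->
     exists a b, [/\ a \in A, b \in B, e a b & f = [set a; b]]).

(* The bound [m] is rational: it need be neither an integer nor nonnegative. *)
Definition Lambda_at (m : rat) (x y : T) : Prop :=
  (m <= #|triangles x y|%:R)%R /\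
  exists M : {set {set T}},
    perfect_matching (nbrs x :\: (common_nbrs x y :|: [set y]))
                     (nbrs y :\: (common_nbrs x y :|: [set x])) M.

Definition Lambda (m : rat) : Prop :=
  forall x y : T, e x y -> Lambda_at m x y.

Definition interval (x y : T) : {set T} :=
  [set z | dist x z + dist z y == dist x y].

Definition strongly_spherical : Prop :=
  (forall x : T, exists x' : T, interval x x' = [set: T]) /\
  (forall x y : T, x != y -> forall z, z \in interval x y ->
     exists2 z', z' \in interval x y & interval x y = interval z z').

End Graphs.

(* Main.v *)
Require Import Defs.
From mathcomp Require Import all_boot all_order all_algebra.
From mathcomp Require Import zify.
Import GRing.Theory Num.Theory.

Set Implicit Arguments.
Unset Strict Implicit.
Unset Printing Implicit Defensive.

(** Write B(x) for the closed unit ball around x and d for the distance.  The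
theorem follows from comparing B(x) with B(y) along edges and geodesics.

At an edge xy, Lambda gives a bijection B(x) -> B(y) that fixes x, y and their
common neighbours and moves the other points along the edges of the perfect
matching.  The bound on the number of triangles says that the number of moved
points is at most D + 1 - 2D/L ([ball_matching]).  Since distances are
1-Lipschitz, the sum S(u, x) of d(u, .) over B(x) grows by at most this amount
along an edge, and starting from S(u, u) = D this bounds S(u, x) by an affine
function of d(u, x) ([ball_sum_le]).  Every vertex lies in exactly D + 1 balls,
so summing over x shows that d(u, .) has mean at most L/2.  If u' is at
distance L from u, the means of d(u, .) and d(u', .) add up to at least L by the
triangle inequality.  Hence every inequality met so far is an equality.  In
particular d(u, w) + d(w, u') = L for all w, which is the antipodality of the
graph itself ([antipode_geodesic]).  Moreover, the matchings are parallel: if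
d(u, .) grows from x to y, it grows by one along each matched edge
([parallel_matching]).

Composing matchings along a geodesic from x to y gives a bijection f from B(x)
to B(y), the transport, which changes d(u, z) by the number m(z) of moves of z,
whenever the geodesic points straight away from u or straight towards it
([transport_exists]).  Now let z be a neighbour of x inside [x, y] and
k = d(x, y).  Transporting x along a geodesic from z to y gives a neighbour z'
of y inside [x, y] with d(z, z') = k ([opposite_exists]); transporting from x to
z' shows that z is determined by z' ([opposite_inj]).  So z |-> z' is a bijection
between the neighbours of x and those of y inside [x, y].  For w in [x, y],
transport through w shows that the numbers d(z, w) + d(w, z') add up to at most
k times their number ([sum_dist_inward]); as each is at least k, all of
them equal k, that is, w is in [z, z'].  Hence [x, y] is contained in [z, z'],
and the same fact applied to [z, z'] and its point x gives equality
([opposite_interval_eq]).  Moving one end of the interval step by step reaches an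
arbitrary z in [x, y]. *)

(** * Finite sums and injections *)

Lemma sum_squeeze (I : finType) (P : pred I) (F G : I -> nat) :
  (forall i, P i -> F i <= G i) ->
  \sum_(i | P i) G i <= \sum_(i | P i) F i ->
  forall i, P i -> F i = G i.
Proof.
move=> leFG leGF i Pi; apply/eqP; rewrite eqn_leq leFG //=.
have leFG' : \sum_(j | P j && (j != i)) F j <= \sum_(j | P j && (j != i)) G j.
  by apply: leq_sum => j /andP[Pj _]; apply: leFG.
move: leGF; rewrite (bigD1 i Pi) [X in _ <= X](bigD1 i Pi) /= => leGF.
rewrite -(leq_add2r (\sum_(j | P j && (j != i)) G j)).
by apply: leq_trans leGF _; rewrite leq_add2l.
Qed.

Lemma imset_eq_of_card (I : finType) (A B : {set I}) (f : I -> I) :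
  {in A &, injective f} -> (forall i, i \in A -> f i \in B) ->
  #|B| <= #|A| -> f @: A = B.
Proof.
move=> f_inj fAB leBA; apply/eqP; rewrite eqEcard card_in_imset // leBA andbT.
by apply/subsetP => _ /imsetP[i iA ->]; apply: fAB.
Qed.

(** * Combinatorial distance *)

Section Distance.

Variables (T : finType) (e : rel T).
Hypotheses (e_sym : symmetric e) (e_irr : irreflexive e).
Hypothesis e_conn : connected_graph e.

Notation d := (dist e).

Lemma dist_le_path (x : T) (p : seq T) :
  path e x p -> d x (last x p) <= size p.
Proof.
move=> pP; case/shortenP: pP => q qP q_uniq q_sub.
have leqp : size q <= size p.
  by apply: uniq_leq_size => //; case/andP: q_uniq.
apply: leq_trans leqp; rewrite leqNgt; apply/negP => lt_qd.
have lt_qT : size q < #|T|.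
  by have := max_card (mem (x :: q)); rewrite (card_uniqP q_uniq).
have := before_find 0 lt_qd.
rewrite nth_iota // add0n => /existsP; case.
by exists (in_tuple q); rewrite qP /=.
Qed.

Lemma dist_path (x y : T) :
  exists2 p, path e x p & last x p = y /\ size p = d x y.
Proof.
have hasP : has (fun n => [exists p : n.-tuple T, path e x p && (last x p == y)])
       (iota 0 #|T|).
  case/connectP: (e_conn x y) => p pP ->; case/shortenP: pP => q qP q_uniq _.
  have lt_qT : size q < #|T|.
    by have := max_card (mem (x :: q)); rewrite (card_uniqP q_uniq).
  apply/hasP; exists (size q); first by rewrite mem_iota.
  by apply/existsP; exists (in_tuple q); rewrite qP /=.
have := nth_find 0 hasP; rewrite nth_iota ?add0n; last first.
  by rewrite -[X in _ < X](size_iota 0) -has_find.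
case/existsP => p /andP[pP /eqP lastp].
by exists p => //; rewrite size_tuple.
Qed.

Lemma distxx (x : T) : d x x = 0.
Proof. by apply/eqP; rewrite -leqn0; apply: (@dist_le_path x [::]). Qed.

Lemma dist_eq0 (x y : T) : d x y = 0 -> x = y.
Proof. by case: (dist_path x y) => p _ [<- <-] /size0nil ->. Qed.

Lemma dist_triangle (x y z : T) : d x z <= d x y + d y z.
Proof.
case: (dist_path x y) => p pP [lastp <-]; case: (dist_path y z) => q qP [lastq <-].
have -> : z = last x (p ++ q) by rewrite last_cat lastp.
rewrite -size_cat; apply: dist_le_path.
by rewrite cat_path pP lastp.
Qed.

Lemma dist_sym (x y : T) : d x y = d y x.
Proof.
suff le_d a b : d a b <= d b a by apply/eqP; rewrite eqn_leq !le_d.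
case: (dist_path b a) => p pP [lastp <-].
have := @dist_le_path a (rev (belast b p)).
rewrite size_rev size_belast -lastp rev_path.
have -> : last (last b p) (rev (belast b p)) = b.
  by case: (p) => //= c q; rewrite rev_cons last_rcons.
by apply; rewrite (@eq_path _ _ e) // => u v; rewrite e_sym.
Qed.

Lemma dist_edge (x y : T) : (d x y == 1) = e x y.
Proof.
apply/eqP/idP => [dxy | exy].
  case: (dist_path x y) => -[|z [|? ?]] /=; rewrite dxy => pP [lastp] //.
  by rewrite -lastp; case/andP: pP.
apply/eqP; rewrite eqn_leq (@dist_le_path x [:: y]) /= ?exy //.
rewrite lt0n; apply/eqP => /dist_eq0 xy.
by rewrite xy e_irr in exy.
Qed.

Lemma dist_step (x y : T) n : d x y = n.+1 -> exists2 z, e x z & d z y = n.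
Proof.
move=> dxy; move: (dxy).
case: (dist_path x y) => -[|z p] /= pP [lastp <-] // [szp].
case/andP: pP => exz pP; exists z => //.
have := dist_le_path pP; have := dist_triangle x z (last z p).
have /eqP -> : d x z == 1 by rewrite dist_edge.
by rewrite -lastp in dxy *; rewrite dxy; lia.
Qed.

(** * Unit balls and triangles *)

Definition ball (x : T) : {set T} := [set z | d x z <= 1].

Lemma in_ball (x z : T) : (z \in ball x) = (z == x) || e x z.
Proof.
rewrite inE leq_eqVlt orbC ltnS leqn0 dist_edge; congr (_ || _).
by apply/eqP/eqP => [/dist_eq0 | ->]; rewrite ?distxx.
Qed.

Lemma ballE (x : T) : ball x = x |: nbrs e x.
Proof. by apply/setP => z; rewrite in_ball !inE. Qed.

Lemma card_ball (x : T) : #|ball x| = #|nbrs e x|.+1.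
Proof. by rewrite ballE cardsU1 inE e_irr. Qed.

Lemma dist_le_diam (x y : T) : d x y <= diam e.
Proof.
apply: (@leq_trans (\max_y d x y)); first exact: (leq_bigmax (F := d x)).
exact: (leq_bigmax (F := fun x => \max_y d x y)).
Qed.

(** A triangle through [x] and [y] is determined by its third vertex. *)
Lemma card_triangles (x y : T) :
  x != y -> #|triangles e x y| <= #|common_nbrs e x y|.
Proof.
move=> xy.
apply: leq_trans (leq_imset_card (fun z => [set x; y; z]) _).
apply/subset_leq_card/subsetP => t.
rewrite inE => /and4P[/eqP t3 xt yt /forall_inP t_clique].
have [z] : exists z, z \in t :\ x :\ y.
  apply/set0Pn; rewrite -card_gt0.
  have := cardsD1 x t; have := cardsD1 y (t :\ x).
  by rewrite xt t3 !inE yt eq_sym xy /=; lia.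
rewrite !inE => /and3P[zy zx zt]; apply/imsetP; exists z.
  rewrite !inE.
  have /forall_inP/(_ z zt) := t_clique x xt; rewrite eq_sym zx => /= ->.
  by have /forall_inP/(_ z zt) := t_clique y yt; rewrite eq_sym zy => /= ->.
apply/esym/eqP; rewrite eqEcard; apply/andP; split.
  by apply/subsetP => a; rewrite !inE => /orP[/orP[]|] /eqP ->.
by rewrite t3 setUC cardsU1 cards2 xy !inE (negPf zx) (negPf zy).
Qed.

(** A matching given as a set of unordered edges becomes a map once [A] and [B]
are disjoint: this fixes which endpoint of an edge is the source, and the
disjointness of the edges is the injectivity of the map. *)
Lemma perfect_matching_fun (A B : {set T}) (M : {set {set T}}) :
  perfect_matching e A B M -> [disjoint A & B] ->
  exists f : T -> T, [/\ {in A &, injective f},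
    forall z, z \in A -> f z \in B & forall z, z \in A -> e z (f z)].
Proof.
case=> /and3P[/eqP covM trivM _] M_edge disjAB.
have notAB z : z \in A -> z \in B -> False.
  by move=> zA zB; rewrite (disjointFr disjAB zA) in zB.
have partner z : z \in A -> exists b, (b \in B) && ([set z; b] \in M) && e z b.
  move=> zA; have : z \in cover M by rewrite covM inE zA.
  case/bigcupP => g gM; have [a [b [aA bB eab g_ab]]] := M_edge g gM.
  rewrite g_ab !inE => /orP[] /eqP z_eq.
    by exists b; rewrite z_eq bB -g_ab gM.
  by case: (notAB z zA); rewrite z_eq.
pose f z := odflt z [pick b | (b \in B) && ([set z; b] \in M) && e z b].
have fP z : z \in A -> [/\ f z \in B, [set z; f z] \in M & e z (f z)].
  move=> zA; rewrite /f; case: pickP => [b /andP[/andP[]] //|none].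
  by case: (partner z zA) => b; rewrite none.
exists f; split=> [z1 z2 z1A z2A f12|z /fP[]//|z /fP[]//].
have [fB1 fM1 _] := fP _ z1A; have [_ fM2 _] := fP _ z2A.
have blk1 := def_pblock trivM fM1 (set22 z1 (f z1)).
have blk2 := def_pblock trivM fM2 (set22 z2 (f z2)).
rewrite -f12 blk1 in blk2.
have : z1 \in [set z2; f z1] by rewrite -blk2 set21.
by rewrite !inE => /orP[] /eqP // z1_eq; case: (notAB z1 z1A); rewrite z1_eq.
Qed.

(** * Matching the balls at the ends of an edge *)

Section Curvature.

Variables (D L : nat).
Hypothesis e_edge : exists x y : T, e x y.
Hypothesis e_reg : regular e D.
Hypothesis e_diam : diam e = L.
Hypothesis e_sc : self_centered e.
Hypothesis e_Lambda : Lambda e (2 * D%:R / L%:R - 2)%R.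

Lemma degree_gt0 : 0 < D.
Proof.
case: e_edge => x [y exy]; rewrite -(e_reg x) card_gt0; apply/set0Pn.
by exists y; rewrite inE.
Qed.

Lemma diam_gt0 : 0 < L.
Proof.
case: e_edge => x [y]; rewrite -dist_edge => /eqP dxy.
by rewrite -e_diam -dxy dist_le_diam.
Qed.

Lemma card_ball_reg (x : T) : #|ball x| = D.+1.
Proof. by rewrite card_ball e_reg. Qed.

(** The triangle bound with denominators cleared, so that the rest of the proof
takes place in the natural numbers. *)
Lemma Lambda_common_nbrs (x y : T) :
  e x y -> 2 * D <= L * (#|common_nbrs e x y| + 2).
Proof.
move=> exy; have [le_t _] := e_Lambda exy.
have xy : x != y by apply: contraTneq exy => ->; rewrite e_irr.
have le_tN := card_triangles xy.
have L0 : (0 < L%:R :> rat)%R by rewrite ltr0n diam_gt0.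
move: le_t; rewrite lerBlDr ler_pdivrMr // -!natrD -!natrM ler_nat => le_t.
by rewrite [X in _ <= X]mulnC; apply: leq_trans le_t _; rewrite leq_mul2r leq_add2r le_tN orbT.
Qed.

(** The matching moves the neighbours of [x] that are neither [y] nor adjacent to
[y], and every other point of the ball stays where it is.  The last clause bounds
the number of moved points by D + 1 - 2D/L, which is the lower bound 2/L for the
Ollivier-Ricci curvature of the edge, in transport form. *)
Lemma ball_matching (x y : T) : e x y ->
  exists f : T -> T, [/\ {in ball x &, injective f},
    forall z, z \in ball x -> f z \in ball y,
    forall z, z \in ball x -> d z (f z) <= 1 &
    L * (\sum_(z in ball x) d z (f z)) + 2 * D <= L * D.+1].
Proof.
move=> exy; have [_ [M M_match]] := e_Lambda exy.
have eyx : e y x by rewrite e_sym.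
set A := nbrs e x :\: (common_nbrs e x y :|: [set y]) in M_match.
set B := nbrs e y :\: (common_nbrs e x y :|: [set x]) in M_match.
have disjAB : [disjoint A & B].
  apply/pred0P => z /=; rewrite !inE; apply/negP.
  by case: (e x z); case: (e y z); rewrite /= ?andbF ?andbT.
have [g [g_inj gB g_edge]] := perfect_matching_fun M_match disjAB.
have cardA : #|A| + #|common_nbrs e x y| + 1 = D.
  rewrite -(e_reg x) -(cardsID (common_nbrs e x y :|: [set y]) (nbrs e x)).
  rewrite -addnA addnC; congr (_ + _).
  rewrite addnC -(cards1 y).
  have -> : nbrs e x :&: (common_nbrs e x y :|: [set y]) = y |: common_nbrs e x y.
    apply/setP => z; rewrite !inE; case: eqVneq => [->|_] //=.
      by rewrite exy orbT.
    by rewrite orbF andbA andbb.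
  by rewrite cardsU1 !inE e_irr andbF cards1 addnC.
(* A fixed point of [f] lies in both balls but outside [B], so that it cannot
   collide with the image of a moved point. *)
pose f z := if z \in A then g z else z.
have out z : z \in ball x -> z \notin A -> (z \in ball y) && (z \notin B).
  rewrite !in_ball !inE; case: (eqVneq z x) => [->|_] /=.
    by rewrite eyx orbT orbT.
  case: (eqVneq z y) => [->|_]; first by rewrite e_irr andbF.
  by case: (e x z); case: (e y z).
exists f; split.
- move=> z1 z2 z1x z2x; rewrite /f.
  case: (boolP (z1 \in A)) => z1A; case: (boolP (z2 \in A)) => z2A //.
  + exact: g_inj.
  + by move=> fz; move: (out _ z2x z2A); rewrite -fz gB // andbF.
  + by move=> fz; move: (out _ z1x z1A); rewrite fz gB // andbF.
- move=> z zx; rewrite /f; case: (boolP (z \in A)) => zA; last first.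
    by case/andP: (out z zx zA).
  by rewrite in_ball; have := gB z zA; rewrite !inE => /andP[_ ->]; rewrite orbT.
- move=> z _; rewrite /f; case: (boolP (z \in A)) => zA; rewrite ?distxx //.
  by have := g_edge z zA; rewrite -dist_edge => /eqP ->.
have -> : \sum_(z in ball x) d z (f z) = #|A|.
  rewrite (bigID (mem A)) /= [X in _ + X]big1 => [|z /andP[_ zA]]; last first.
    by rewrite /f (negPf zA) distxx.
  rewrite addn0 -sum1_card; apply: eq_big => [z|z /andP[_ zA]].
    rewrite in_ball !inE; case: (e x z); rewrite ?orbT ?andbF //.
  by rewrite /f zA; have := g_edge z zA; rewrite -dist_edge => /eqP.
apply: leq_trans (leq_add (leqnn _) (Lambda_common_nbrs exy)) _.
by rewrite -mulnDr leq_mul2l -cardA; apply/orP; right; lia.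
Qed.

(** * Mean distance and antipodality of the graph *)

Lemma ball_sum_reindex (x y : T) (f : T -> T) (F : T -> nat) :
  {in ball x &, injective f} -> (forall z, z \in ball x -> f z \in ball y) ->
  \sum_(z in ball y) F z = \sum_(z in ball x) F (f z).
Proof.
move=> f_inj fB; rewrite -(imset_eq_of_card f_inj fB) ?card_ball_reg //.
by rewrite big_imset.
Qed.

Definition ball_sum (u x : T) : nat := \sum_(w in ball x) d u w.

Lemma ball_sumxx (u : T) : ball_sum u u = D.
Proof.
rewrite /ball_sum ballE big_setU1 ?inE ?e_irr //= distxx add0n -(e_reg u).
rewrite -sum1_card; apply: eq_bigr => z; rewrite inE -dist_edge.
by move/eqP.
Qed.

(** Each edge of a geodesic from [u] to [x] raises [ball_sum u] by at most the cost
of the matching on that edge, which is at most D + 1 - 2D/L. *)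
Lemma ball_sum_le (u x : T) :
  L * ball_sum u x + 2 * D * d u x <= L * D + L * D.+1 * d u x.
Proof.
move dux: (d u x) => k; elim: k x dux => [|k IHk] x dux.
  by rewrite -(dist_eq0 dux) ball_sumxx !muln0.
have [y exy dyu] : exists2 y, e x y & d y u = k.
  by apply: dist_step; rewrite dist_sym.
rewrite dist_sym in dyu; rewrite e_sym in exy.
have [f [f_inj fB _ cost]] := ball_matching exy.
have le_xy : ball_sum u x <= ball_sum u y + \sum_(z in ball y) d z (f z).
  rewrite /ball_sum (ball_sum_reindex _ f_inj fB) -big_split /=.
  by apply: leq_sum => z _; apply: dist_triangle.
have := leq_mul (leqnn L) le_xy; rewrite mulnDr.
by move: (IHk y dyu) cost; rewrite !mulnS; lia.
Qed.

(** Double counting: each vertex lies in D + 1 balls. *)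
Lemma sum_ball_sum (u : T) : \sum_x ball_sum u x = D.+1 * \sum_w d u w.
Proof.
rewrite (exchange_big_dep predT) //= big_distrr /=; apply: eq_bigr => w _.
rewrite -(card_ball_reg w) -sum_nat_const; apply: eq_bigl => x.
by rewrite !inE dist_sym.
Qed.

(** The sum of [ball_sum_le] over all [x]; the terms in L (D + 1) cancel.  The
right-hand side stands for the number of vertices times [L]. *)
Lemma sum_dist_le (u : T) : 2 * \sum_w d u w <= \sum_(w : T) L.
Proof.
have : \sum_x (L * ball_sum u x + 2 * D * d u x) <=
       \sum_x (D * L + L * D.+1 * d u x).
  by apply: leq_sum => x _; rewrite [D * L]mulnC; apply: ball_sum_le.
rewrite !big_split /= -!big_distrr /= sum_ball_sum.
rewrite mulnA addnC leq_add2r => le_D.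
by rewrite -(leq_pmul2l degree_gt0) mulnA [D * 2]mulnC.
Qed.

(** By the triangle inequality the left-hand side is at least [L] for each [w], and
[sum_dist_le] for [u] and [u'] says that its mean is at most [L]. *)
Lemma antipode_geodesic (u u' w : T) : d u u' = L -> d u w + d w u' = L.
Proof.
move=> duu'; apply/esym.
apply: (@sum_squeeze _ xpredT (fun=> L) (fun w => d u w + d w u')) => //.
  by move=> i _; rewrite -duu' dist_triangle.
rewrite big_split /=.
have -> : \sum_i d i u' = \sum_i d u' i by apply: eq_bigr => i _; rewrite dist_sym.
by have := sum_dist_le u; have := sum_dist_le u'; lia.
Qed.

(** Self-centeredness enters here: every vertex [u] has an antipode. *)
Lemma sum_dist (u : T) : 2 * \sum_w d u w = \sum_(w : T) L.
Proof.
have [u' duu'] := e_sc u; rewrite e_diam in duu'.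
have sum_uu' : \sum_w d u w + \sum_w d u' w = \sum_(w : T) L.
  rewrite -big_split /=; apply: eq_bigr => w _.
  by rewrite [d u' w]dist_sym antipode_geodesic.
by have := sum_dist_le u; have := sum_dist_le u'; lia.
Qed.

(** The two sides of [ball_sum_le] have the same sum over [x], by [sum_dist], hence
agree for each [x]. *)
Lemma ball_sum_eq (u x : T) :
  L * ball_sum u x + 2 * D * d u x = L * D + L * D.+1 * d u x.
Proof.
pose F x := L * ball_sum u x + 2 * D * d u x.
pose G x := D * L + L * D.+1 * d u x.
rewrite [L * D]mulnC; apply: (@sum_squeeze _ xpredT F G) => // [z _|].
  by rewrite /G [D * L]mulnC; apply: ball_sum_le.
rewrite /F /G !big_split /= -!big_distrr /= sum_ball_sum.
by rewrite -(sum_dist u) !mulnA addnC [D * 2]mulnC.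
Qed.

(** The equality case of the estimate in [ball_sum_le]: by [ball_sum_eq] the sum of
d(u, .) changes from one ball to the other by as much as the matching can cost, so
each triangle inequality d(u, f z) <= d(u, z) + d(z, f z) is an equality.  The
last two clauses treat edges leading away from [u] and towards [u]; nothing is
claimed for edges whose ends are equidistant from [u]. *)
Lemma parallel_matching (x y : T) : e x y ->
  exists f : T -> T, [/\ {in ball x &, injective f},
    forall z, z \in ball x -> f z \in ball y,
    forall z, z \in ball x -> d z (f z) <= 1,
    forall u z, z \in ball x -> d u y = d u x + 1 ->
      d u (f z) = d u z + d z (f z) &
    forall u z, z \in ball x -> d u x = d u y + 1 ->
      d u z = d u (f z) + d z (f z)].
Proof.
move=> exy; have [f [f_inj fB f1 cost]] := ball_matching exy.
exists f; split=> // u z zx duxy.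
  apply: (sum_squeeze (P := mem (ball x)) (F := fun z => d u (f z)) (G := fun z => d u z + d z (f z)) _ _ zx).
    by move=> i _; apply: dist_triangle.
  rewrite big_split /= -(ball_sum_reindex (d u) f_inj fB).
  rewrite -(leq_pmul2l diam_gt0) mulnDr.
  have := ball_sum_eq u x; have := ball_sum_eq u y; rewrite duxy /ball_sum.
  by rewrite !mulnDr !muln1; lia.
apply: (sum_squeeze (P := mem (ball x)) (F := d u) (G := fun z => d u (f z) + d z (f z)) _ _ zx).
  by move=> i _; rewrite [d i _]dist_sym; apply: dist_triangle.
rewrite big_split /= -(ball_sum_reindex (d u) f_inj fB).
rewrite -(leq_pmul2l diam_gt0) mulnDr.
have := ball_sum_eq u x; have := ball_sum_eq u y; rewrite duxy /ball_sum.
by rewrite !mulnDr !muln1; lia.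
Qed.

(** * Transport along geodesics *)

(** [m z] counts the moves of [z].  The geodesic itself is forgotten: what matters
is how [f] changes the distance to vertices [u] from which the geodesic points
straight away (fourth clause) or to which it points straight back (fifth
clause). *)
Definition transport (x y : T) (f : T -> T) (m : T -> nat) : Prop :=
  [/\ {in ball x &, injective f},
      forall z, z \in ball x -> f z \in ball y,
      forall z, z \in ball x -> m z <= d x y,
      forall u z, z \in ball x -> d u y = d u x + d x y ->
        d u (f z) = d u z + m z &
      forall u z, z \in ball x -> d u x = d u y + d x y ->
        d u z = d u (f z) + m z].

(** If x, w, y lie on a geodesic that points away from [u], then so do both of its
parts, hence the move counts add up. *)
Lemma transport_comp (x w y : T) f1 m1 f2 m2 :
  d x y = d x w + d w y -> transport x w f1 m1 -> transport w y f2 m2 ->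
  transport x y (f2 \o f1) (fun z => m1 z + m2 (f1 z)).
Proof.
move=> dxy [inj1 map1 le1 up1 down1] [inj2 map2 le2 up2 down2].
split=> [z1 z2 z1x z2x /= eqf|z zx|z zx|u z zx duy|u z zx dux] /=.
- by apply: inj1 => //; apply: inj2 => //; apply: map1.
- by apply/map2/map1.
- by rewrite dxy leq_add ?le1 ?le2 ?map1.
- have := dist_triangle u x w; have := dist_triangle u w y => tri1 tri2.
  rewrite up2 ?map1 //; last by lia.
  by rewrite up1 // ?addnA //; lia.
- have := dist_triangle u y w; have := dist_triangle u w x => tri1 tri2.
  have dwx := dist_sym w x; have dyw := dist_sym y w.
  have duw : d u x = d u w + d x w by lia.
  have duy : d u w = d u y + d w y by lia.
  by rewrite (down1 u z) // (down2 u (f1 z)) ?map1 //; lia.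
Qed.

Lemma transport_exists (x y : T) : exists f m, transport x y f m.
Proof.
move dxy: (d x y) => n; elim: n x dxy => [|n IHn] x dxy.
  rewrite (dist_eq0 dxy); exists id, (fun=> 0).
  by split=> // *; rewrite addn0.
have [w exw dwy] := dist_step dxy.
have dxw : d x w = 1 by apply/eqP; rewrite dist_edge.
have [f2 [m2 tr2]] := IHn w dwy.
have [f1 [inj1 map1 le1 up1 down1]] := parallel_matching exw.
exists (f2 \o f1), (fun z => d z (f1 z) + m2 (f1 z)).
apply: transport_comp tr2; first by rewrite dxy dxw dwy add1n.
by split=> // [z zx|u z zx|u z zx]; rewrite dxw; [exact: le1|exact: up1|exact: down1].
Qed.

(** * Opposite vertices in an interval *)

Definition interval_ball (x y : T) : {set T} := ball x :&: Defs.interval e x y.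

Lemma in_interval_ball (x y z : T) :
  (z \in interval_ball x y) = (d x z <= 1) && (d x z + d z y == d x y).
Proof. by rewrite !inE. Qed.

(** With [u := x] and [u := y], transport raises the distance to [x] and lowers the
distance to [y] by the same amount. *)
Lemma transport_interval_ball (x y z : T) f m :
  transport x y f m -> z \in interval_ball x y -> f z \in interval_ball y x.
Proof.
move=> [_ map_f _ up down] /setIP[zx]; rewrite in_setI map_f //= !inE => /eqP zxy.
have := up x z zx; rewrite distxx add0n => /(_ erefl) dxfz.
have := down y z zx; rewrite distxx add0n => /(_ (dist_sym y x)) dyz.
by rewrite (dist_sym (f z)) (dist_sym y x) -zxy dxfz (dist_sym z) dyz; lia.
Qed.

Lemma card_interval_ball (x y : T) :
  #|interval_ball x y| = #|interval_ball y x|.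
Proof.
suff le_card a b : #|interval_ball a b| <= #|interval_ball b a|.
  by apply/eqP; rewrite eqn_leq !le_card.
have [f [m tr]] := transport_exists a b; have [f_inj _ _ _ _] := tr.
rewrite -(card_in_imset (f := f) (D := mem (interval_ball a b))); last first.
  by move=> z1 z2 /setIP[z1a _] /setIP[z2a _]; apply: f_inj.
apply/subset_leq_card/subsetP => _ /imsetP[z zab ->].
exact: transport_interval_ball tr zab.
Qed.

(** The first vertices after [x] on the geodesics from [x] to [y]; see
[in_inward]. *)
Definition inward (x y : T) : {set T} := interval_ball x y :\ x.

Lemma in_inward (x y z : T) :
  (z \in inward x y) = e x z && (d x y == (d z y).+1).
Proof.
rewrite in_setD1 in_interval_ball -dist_edge.
case: eqVneq => [->|zx] /=; first by rewrite distxx.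
have : d x z != 0 by apply: contraNneq zx => /dist_eq0 ->.
by case: (d x z) => [|[|n]] //= _; rewrite add1n eq_sym.
Qed.

Lemma mem_interval_ball (x y : T) : x \in interval_ball x y.
Proof. by rewrite in_interval_ball distxx add0n eqxx. Qed.

Lemma card_inward (x y : T) : #|inward x y| = #|inward y x|.
Proof.
have := card_interval_ball x y.
by rewrite (cardsD1 x) (cardsD1 y (interval_ball y x)) !mem_interval_ball => -[].
Qed.

(** The opposite vertex is the image of [x] under transport from [z] to [y].  That
path has d(x, y) - 1 edges and the image lies in B(y), at distance
d(x, y) - m(x) from [y]; so [x] moves at every step, always away from [z]. *)
Lemma opposite_exists (x y z : T) : z \in inward x y ->
  exists2 z', z' \in inward y x & d z z' = d x y.
Proof.
rewrite in_inward -dist_edge => /andP[/eqP dxz /eqP dxy].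
have [f [m [_ map_f le_m up down]]] := transport_exists z y.
have xz : x \in ball z by rewrite inE dist_sym dxz.
have fxy : d y (f x) <= 1 by have := map_f x xz; rewrite inE.
have dzf : d z (f x) = d z x + m x by apply: up => //; rewrite distxx.
have dyx : d y x = d y (f x) + m x.
  by apply: down => //; rewrite distxx (dist_sym y).
have dxf : d x (f x) = d x x + m x by apply: up => //; rewrite dxy dxz.
have := le_m x xz; rewrite (dist_sym z x) dxz in dzf.
rewrite distxx in dxf; rewrite (dist_sym y x) in dyx => le_mx.
exists (f x); last by lia.
by rewrite in_inward -dist_edge (dist_sym (f x)) (dist_sym y x); lia.
Qed.

(** Every vertex [z] inward from [x] at distance d(x, y) from [z'] is sent to [y] by
transport from [x] to [z']: its image is in B(z'), so [z] must move at every step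
to come near enough, and each move also brings it nearer to [y]. *)
Lemma opposite_inj (x y z1 z2 z' : T) :
  z1 \in inward x y -> z2 \in inward x y -> z' \in inward y x ->
  d z1 z' = d x y -> d z2 z' = d x y -> z1 = z2.
Proof.
have [f [m [f_inj map_f _ up down]]] := transport_exists x z'.
move=> z1A z2A; rewrite in_inward -dist_edge => /andP[/eqP dyz' /eqP dyx].
have ball_x z : z \in inward x y -> z \in ball x.
  by case/setD1P => _ /setIP[].
have f_eq z : z \in inward x y -> d z z' = d x y -> f z = y.
  move=> zA dzz'; have zx := ball_x z zA.
  have fzz' := map_f z zx; rewrite inE in fzz'.
  have dyz : d y z = d y (f z) + m z.
    by apply: down => //; rewrite dyx dyz' (dist_sym x).
  have dz'z : d z' z = d z' (f z) + m z.
    by apply: down => //; rewrite distxx (dist_sym x).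
  apply/esym/dist_eq0.
  move: zA; rewrite in_inward => /andP[_ /eqP dxy].
  by move: dz'z dyz; rewrite (dist_sym z') dzz' (dist_sym y z); lia.
by move=> d1 d2; apply: f_inj; rewrite ?ball_x // !f_eq.
Qed.

(** Transport from [x] to [y] through [w] maps P = {x} + [inward x y] onto
P' = {y} + [inward y x].  For z in P with image v in B(w), the distances from [w] to
[z] and to its image in P' are d(w, v) plus the moves before and after [w].  So
the sum of the distances to [w] over P and P' is twice the sum of d(w, v), plus the
total number of moves.  The first sum is at most |P| - 1, since one v is [w]
itself; the number of moves is read off from the distances to [y], which
decrease by one with each move. *)
Lemma sum_dist_inward (x y w : T) : w \in Defs.interval e x y -> x != y ->
  \sum_(z in inward x y) d z w + \sum_(z in inward y x) d z w <=
    d x y * #|inward x y|.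
Proof.
rewrite inE => /eqP xwy xy.
have dxy_gt0 : 0 < d x y by rewrite lt0n; apply: contraNneq xy => /dist_eq0 ->.
have [f1 [m1 tr1]] := transport_exists x w.
have [f2 [m2 tr2]] := transport_exists w y.
have tr := transport_comp (esym xwy) tr1 tr2.
set g := f2 \o f1 in tr; set m := fun z => _ in tr.
pose P := interval_ball x y; pose P' := interval_ball y x.
have Pball z : z \in P -> z \in ball x by case/setIP.
have [g_inj _ _ _ down] := tr.
have gP : g @: P = P'.
  apply: imset_eq_of_card.
  - by move=> z1 z2 /Pball z1x /Pball z2x; apply: g_inj.
  - by move=> z; apply: transport_interval_ball tr.
  - by rewrite card_interval_ball.
have sumP' F : \sum_(z in P') F z = \sum_(z in P) F (g z).
  rewrite -gP big_imset //.
  by move=> z1 z2 /Pball z1x /Pball z2x; apply: g_inj.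
have splitP F : \sum_(z in P) F z = F x + \sum_(z in inward x y) F z.
  by rewrite (big_setD1 x) ?mem_interval_ball.
have splitP' F : \sum_(z in P') F z = F y + \sum_(z in inward y x) F z.
  by rewrite (big_setD1 y) ?mem_interval_ball.
have total_m : \sum_(z in P) d y z = \sum_(z in P') d y z + \sum_(z in P) m z.
  rewrite sumP' -big_split; apply: eq_bigr => z /Pball zx.
  by apply: down => //; rewrite distxx (dist_sym y).
have sum_w : \sum_(z in P) d z w + \sum_(z in P') d z w =
    2 * \sum_(z in P) d w (f1 z) + \sum_(z in P) m z.
  rewrite sumP' -big_split big_distrr -big_split /=.
  apply: eq_bigr => z /Pball zx.
  have [_ map1 _ _ down1] := tr1; have [_ _ _ up2 _] := tr2.
  have f1zw := map1 z zx.
  rewrite (dist_sym z) (dist_sym (f2 _)) (up2 w (f1 z)) ?distxx //.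
  by rewrite (down1 w z) ?distxx ?(dist_sym w) // /m; lia.
(* The point [z0] arriving at [w] belongs to the interval because its moves
   lengthen the distance to [x] and shorten the distance to [y]. *)
have [z0 z0P f1z0] : exists2 z0, z0 \in P & f1 z0 = w.
  have [inj1 map1 _ up1 down1] := tr1.
  have : w \in f1 @: ball x.
    by rewrite (imset_eq_of_card inj1 map1) ?card_ball_reg // inE distxx.
  case/imsetP => z0 z0x w_eq; exists z0; last by [].
  rewrite in_interval_ball; rewrite inE in z0x; rewrite z0x /=.
  have := up1 x z0; rewrite distxx inE => /(_ z0x erefl).
  have := down1 y z0; rewrite inE !(dist_sym y) -xwy addnC => /(_ z0x erefl).
  by rewrite -w_eq; lia.
have sum_f1 : \sum_(z in P) d w (f1 z) <= #|inward x y|.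
  have -> : #|inward x y| = #|P :\ z0|.
    have := cardsD1 z0 P; rewrite z0P (cardsD1 x P) mem_interval_ball.
    by case.
  rewrite (big_setD1 z0) //= f1z0 distxx add0n -sum1_card.
  apply: leq_sum => z /setD1P[_ /Pball zx].
  by have [_ /(_ z zx)] := tr1; rewrite inE.
(* On [inward x y] the distance to [y] is d(x, y) - 1, written with a successor to
   avoid subtraction; on [inward y x] it is 1. *)
have sum_y : \sum_(z in inward x y) (d y z).+1 = \sum_(z in inward x y) d x y.
  apply: eq_bigr => z; rewrite in_inward => /andP[_ /eqP ->].
  by rewrite (dist_sym y).
have sum_y' : \sum_(z in inward y x) d y z = \sum_(z in inward y x) 1.
  by apply: eq_bigr => z; rewrite in_inward -dist_edge => /andP[/eqP ->].
have splitS : \sum_(z in inward x y) (d y z).+1 =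
    \sum_(z in inward x y) d y z + #|inward x y|.
  by rewrite -sum1_card -big_split /=; apply: eq_bigr => z _; rewrite addn1.
rewrite sum_nat_const in sum_y; rewrite sum1_card -card_inward in sum_y'.
have := sum_w; rewrite splitP splitP'; move: total_m; rewrite splitP splitP'.
rewrite distxx (dist_sym y x) (dist_sym y w) mulnC; lia.
Qed.

(** For [w] in the interval, each d(v, w) + d(w, v') with v' opposite to v is at least
d(v, v') = d(x, y), and [sum_dist_inward] bounds their sum from above by the same
value, because v |-> v' is a bijection. *)
Lemma opposite_interval_sub (x y z : T) : z \in inward x y ->
  exists2 z', d z z' = d x y & Defs.interval e x y \subset Defs.interval e z z'.
Proof.
move=> zA.
(* The default value [v] is never used on [inward x y], where an opposite vertex
   exists. *)
pose opp v := odflt v [pick v' in inward y x | d v v' == d x y].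
have oppP v : v \in inward x y -> opp v \in inward y x /\ d v (opp v) = d x y.
  move=> vA; rewrite /opp; case: pickP => [v' /andP[v'A /eqP dvv'] //|none].
  by have [v' v'A dvv'] := opposite_exists vA; have := none v'; rewrite v'A dvv' eqxx.
have [ozA dzoz] := oppP z zA; exists (opp z) => //.
apply/subsetP => w wxy; rewrite inE dzoz.
have xy : x != y.
  by apply: contraTneq zA => ->; rewrite in_inward distxx andbF.
apply/eqP/esym.
apply: (@sum_squeeze _ (mem (inward x y)) (fun=> d x y)
  (fun v => d v w + d w (opp v))) => // [v vA|].
  by have [_ <-] := oppP v vA; apply: dist_triangle.
rewrite sum_nat_const mulnC big_split /=.
apply: leq_trans (sum_dist_inward wxy xy).
rewrite leq_add2l.
have opp_inj : {in inward x y &, injective opp}.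
  move=> v1 v2 v1A v2A eq_opp; have [o1A d1] := oppP v1 v1A.
  by have [_ d2] := oppP v2 v2A; apply: opposite_inj o1A d1 _; rewrite ?eq_opp.
have <- : opp @: inward x y = inward y x.
  apply: imset_eq_of_card => // [v /oppP[]//|].
  by rewrite card_inward.
by rewrite big_imset //=; apply: leq_sum => v _; rewrite dist_sym.
Qed.

(** Applying the inclusion twice gives [x, y] inside [z, z'] inside [x, y'] with y' at
distance d(x, y) from [x]; but [y] lies in [x, y'] at that distance, so y = y'. *)
Lemma opposite_interval_eq (x y z : T) : z \in inward x y ->
  exists2 z', d z z' = d x y & Defs.interval e x y = Defs.interval e z z'.
Proof.
move=> zA; have [z' dzz' sub] := opposite_interval_sub zA.
exists z' => //; apply/eqP; rewrite eqEsubset sub /=.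
have x_zz' : x \in Defs.interval e z z' by apply: (subsetP sub); rewrite inE distxx.
have xA : x \in inward z z'.
  move: zA x_zz'; rewrite !in_inward inE -!dist_edge => /andP[/eqP dxz _].
  by rewrite (dist_sym z) dxz add1n eq_sym => ->.
have [y' dxy' sub'] := opposite_interval_sub xA.
suff -> : y = y' by [].
have : y \in Defs.interval e x y'.
  by apply/(subsetP sub')/(subsetP sub); rewrite inE distxx addn0.
rewrite inE dxy' dzz' -[X in _ == X]addn0 eqn_add2l => /eqP.
exact: dist_eq0.
Qed.

(** Replacing [x] by its successor on a geodesic to [z] keeps the interval and brings
its end nearer to [z]. *)
Lemma interval_antipodal (x y z : T) : z \in Defs.interval e x y ->
  exists z', Defs.interval e x y = Defs.interval e z z'.
Proof.
move dxz: (d x z) => n; elim: n x y dxz => [|n IHn] x y dxz zxy.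
  by exists y; rewrite (dist_eq0 dxz).
have [v exv dvz] := dist_step dxz.
have vA : v \in inward x y.
  rewrite in_inward exv /=; move: zxy; rewrite inE => /eqP.
  have := dist_triangle x v y; have := dist_triangle v z y.
  by move: exv; rewrite -dist_edge => /eqP ->; lia.
have [v' _ eq_int] := opposite_interval_eq vA.
by rewrite eq_int in zxy *; apply: IHn.
Qed.

Lemma Lambda_strongly_spherical : strongly_spherical e.
Proof.
split=> [x|x y _ z zxy].
  have [x' dxx'] := e_sc x; rewrite e_diam in dxx'; exists x'.
  by apply/setP => w; rewrite !inE dxx' antipode_geodesic ?eqxx.
have [z' eq_int] := interval_antipodal zxy; exists z' => //.
by rewrite eq_int inE distxx addn0.
Qed.

End Curvature.

End Distance.

(** * Strong sphericity *)

Theorem theorem1p13 (T : finType) (e : rel T) (D L : nat)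
    (e_sym : symmetric e) (e_irr : irreflexive e)
    (e_conn : connected_graph e) (e_edge : exists x y : T, e x y)
    (e_reg : regular e D) (e_diam : diam e = L)
    (e_sc : self_centered e)
    (e_Lambda : Lambda e (2 * D%:R / L%:R - 2)%R) :
  strongly_spherical e.
Proof. exact: (@Lambda_strongly_spherical T e e_sym e_irr e_conn D L). Qed.
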